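(* For every integer $n\ge 1$, the simple $3$-threshold sequences of length $n$ are in bijection with the ternary trees with $n$ internal nodes.
   Context: A simple $3$-threshold sequence of length $n$ is a strictly increasing sequence $(s_1s_2\ldots s_n)$ of integers such that $3i\le s_i\le 3n$ for all $1\le i\le n$. A ternary tree is a rooted tree in which every internal node has exactly three children, ordered from left to right; it is either trivial (a unique node, which is not internal) or consists of an internal root node and three ordered ternary subtrees. Two ternary trees are equal iff both are trivial, or both are non-trivial with the same subtrees in the same order. *)

(* Defs.v *)
From mathcomp Require Import all_boot all_order all_algebra.

Set Implicit Arguments.
Unset Strict Implicit.
Unset Printing Implicit Defensive.

Import Order.TTheory GRing.Theory Num.Theory.

(* Tuples are indexed from 0: the i-th entry, for i : 'I_n, is s_(i+1). *)
Definition is_simple_3threshold (n : nat) (s : n.-tuple int) : bool :=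
  sorted <%R s
  && [forall i : 'I_n, ((3 * i.+1)%:Z <= tnth s i <= (3 * n)%:Z)%R].

Definition simple_3threshold_seq (n : nat) : Type :=
  {s : n.-tuple int | is_simple_3threshold s}.

Inductive ternary_tree : Type :=
| TTrivial
| TNode of ternary_tree & ternary_tree & ternary_tree.

Fixpoint internal_nodes (t : ternary_tree) : nat :=
  match t with
  | TTrivial => 0
  | TNode l m r =>
      (internal_nodes l + internal_nodes m + internal_nodes r).+1
  end.

Definition ternary_tree_with (n : nat) : Type :=
  {t : ternary_tree | internal_nodes t == n}.

(* Main.v *)
(** A ternary tree is read in postorder, [false] for a leaf and [true] for an
    internal node, giving a word of length [3n+1] with [n] letters [true].  A
    stack machine that pushes a leaf on [false] and pops three subtrees on [true]
    inverts this code; it never underflows exactly when every nonempty prefix of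
    length [k] contains fewer than [k/3] letters [true].  In terms of the
    positions [s_1 < ... < s_n] of the letters [true], counted from 0, this
    ballot condition reads [3i <= s_i]. *)
Require Import Defs.
From mathcomp Require Import all_boot all_order all_algebra.
From mathcomp Require Import zify.

Set Implicit Arguments.
Unset Strict Implicit.
Unset Printing Implicit Defensive.

(** * Postorder words, the stack machine and the ballot condition *)

Fixpoint postorder (t : ternary_tree) : bitseq :=
  match t with
  | TTrivial => [:: false]
  | TNode l m r => rcons (postorder l ++ postorder m ++ postorder r) true
  end.

(* The last case is an underflow and does not matter. *)
Definition stack_step (st : seq ternary_tree) (b : bool) : seq ternary_tree :=
  match b, st with
  | false, _ => TTrivial :: st
  | true, [:: r, m, l & st'] => TNode l m r :: st'
  | true, _ => st
  end.

Definition parse (w : bitseq) : seq ternary_tree := foldl stack_step [::] w.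

(** The top of the stack is the head of the list, so reversal restores the order of reading. *)
Definition stack_word (st : seq ternary_tree) : bitseq :=
  flatten (map postorder (rev st)).

Definition ballot (w : bitseq) : Prop :=
  forall k, 0 < k -> 3 * count id (take k w) < k.

Lemma size_postorder t : size (postorder t) = (3 * internal_nodes t).+1.
Proof.
elim: t => //= l IHl m IHm r IHr.
by rewrite size_rcons !size_cat IHl IHm IHr; lia.
Qed.

Lemma count_postorder t : count id (postorder t) = internal_nodes t.
Proof.
elim: t => //= l IHl m IHm r IHr.
by rewrite -cats1 !count_cat /= IHl IHm IHr; lia.
Qed.

Lemma foldl_postorder t st : foldl stack_step st (postorder t) = t :: st.
Proof.
elim: t st => //= l IHl m IHm r IHr st.
by rewrite foldl_rcons !foldl_cat IHl IHm IHr.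
Qed.

Lemma ballot_size w : ballot w -> 3 * count id w <= size w.
Proof.
case: w => // b w /(_ (size w).+1 isT); rewrite take_oversize //; exact: ltnW.
Qed.

Lemma ballot_cat u v : ballot u -> ballot v -> ballot (u ++ v).
Proof.
move=> bu bv k k_gt0; rewrite take_cat; case: (ltnP k (size u)) => [_|le_uk]; first exact: (bu k k_gt0).
rewrite count_cat; have := ballot_size bu.
(* At the seam [k = size u] the weak bound of [ballot_size] does not suffice; the strict bound for
   [u] itself is used. *)
have [k_eq|lt_uk] := posnP (k - size u).
  rewrite k_eq take0 /=; have := bu k k_gt0.
  by rewrite take_oversize //; lia.
by have := bv _ lt_uk; lia.
Qed.

Lemma ballot_rcons w (b : bool) :
  ballot w -> 3 * (count id w + b) < (size w).+1 -> ballot (rcons w b).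
Proof.
move=> bw bound k k_gt0; case: (leqP k (size w)) => [le_kw|lt_wk].
  by rewrite -cats1 takel_cat //; exact: (bw k k_gt0).
by rewrite take_oversize ?size_rcons // -cats1 count_cat /=; lia.
Qed.

Lemma ballot_rconsl w b : ballot (rcons w b) -> ballot w.
Proof.
move=> bw k k_gt0; case: (leqP k (size w)) => [le_kw|lt_wk].
  by have := bw k k_gt0; rewrite -cats1 takel_cat.
rewrite take_oversize ?(ltnW lt_wk) //.
case: w bw lt_wk => //= c w /(_ (size w).+1 isT).
by rewrite -cats1 /= takel_cat // take_size; lia.
Qed.

Lemma ballot_postorder t : ballot (postorder t).
Proof.
elim: t => [|l IHl m IHm r IHr] /=; first by case=> [|[|k]].
(* Each subtree's word has length one more than three times its count; these three spare letters pay
   for the final [true] and leave strictness. *)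
apply: ballot_rcons; first by do 2?apply: ballot_cat.
by rewrite !count_cat !size_cat !count_postorder !size_postorder; lia.
Qed.

Lemma stack_word_cons t st : stack_word (t :: st) = stack_word st ++ postorder t.
Proof. by rewrite /stack_word rev_cons map_rcons flatten_rcons. Qed.

(** Reading [false] adds one tree to the stack and reading [true] removes two, so the stack height
    is the excess of the length over three times the count. *)
Lemma ballot_parse w : ballot w ->
  size (parse w) + 3 * count id w = size w /\ stack_word (parse w) = w.
Proof.
elim/last_ind: w => [|w b IHw] // bw.
have [szw wordw] := IHw (ballot_rconsl bw).
have := bw (size w).+1 isT; rewrite take_oversize ?size_rcons //.
rewrite /parse foldl_rcons -/(parse w) -cats1 count_cat /=.
case: b {bw} => /= [bound|_].
  (* The ballot bound for the word including this [true] forces height at least 3, which rules out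
     underflow. *)
  move: szw wordw; case: (parse w) => [|r [|m [|l st]]] /= szw; try lia.
  move=> wordw; split; first lia.
  by rewrite -wordw !stack_word_cons /= -cats1 !catA.
by rewrite stack_word_cons wordw; split => //; lia.
Qed.

(** The final height is (3n+1) - 3n = 1, so [head] never returns its default. *)
Lemma postorder_parse w n :
    ballot w -> size w = (3 * n).+1 -> count id w = n ->
  postorder (head TTrivial (parse w)) = w.
Proof.
move=> bw szw cw; have [] := ballot_parse bw; rewrite szw cw.
case: (parse w) => [|t [|t' st]] /= szst; try lia.
by rewrite stack_word_cons.
Qed.

(** * Words and the positions of their letters [true] *)

Definition true_positions (w : bitseq) : seq nat :=
  [seq p <- iota 0 (size w) | nth false w p].

Definition word_of_positions (m : nat) (s : seq nat) : bitseq :=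
  [seq p \in s | p <- iota 0 m].

Lemma sorted_true_positions w : sorted ltn (true_positions w).
Proof. exact/(sorted_filter ltn_trans)/iota_ltn_sorted. Qed.

Lemma mem_true_positions w p : (p \in true_positions w) = nth false w p.
Proof.
rewrite mem_filter mem_iota add0n leq0n /=.
by case: ltnP => [_|le_wp]; rewrite ?andbT // nth_default.
Qed.

Lemma true_positionsK w : word_of_positions (size w) (true_positions w) = w.
Proof.
rewrite /word_of_positions (eq_map (mem_true_positions w)).
exact: mkseq_nth.
Qed.

Lemma word_of_positionsK m s : sorted ltn s -> all (fun p => p < m) s ->
  true_positions (word_of_positions m s) = s.
Proof.
move=> s_sorted /allP s_lt.
apply: (irr_sorted_eq ltn_trans ltnn (sorted_true_positions _) s_sorted) => p.
rewrite mem_true_positions /word_of_positions.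
case: (ltnP p m) => [lt_pm|le_mp].
  by rewrite (nth_map 0) ?size_iota // nth_iota.
rewrite nth_default ?size_map ?size_iota //.
by apply/esym/negP => /s_lt; rewrite ltnNge le_mp.
Qed.

Lemma count_take_true_positions w k :
  count id (take k w) = count (fun p => p < k) (true_positions w).
Proof.
elim/last_ind: w => [|w b IHw] //.
rewrite /true_positions size_rcons -addn1 iotaD cats1 add0n filter_rcons nth_rcons.
rewrite ltnn eqxx (@eq_in_filter _ _ (nth false w)); last first.
  by move=> p; rewrite mem_iota nth_rcons => /andP[_]; rewrite add0n => ->.
rewrite -/(true_positions w).
have -> s : count (fun p => p < k) (if b then rcons s (size w) else s)
    = count (fun p => p < k) s + b * (size w < k).
  by case: b; rewrite ?mul1n ?addn0 // -cats1 count_cat /= addn0.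
rewrite -IHw -cats1 take_cat.
case: (ltngtP k (size w)) => [_|lt_wk|->].
- by rewrite muln0 addn0.
- rewrite (@take_oversize _ k w) ?(ltnW lt_wk) // count_cat muln1.
  by rewrite take_oversize /= ?addn0 // subn_gt0.
- by rewrite subnn take0 cats0 take_size muln0 addn0.
Qed.

Lemma size_true_positions w : size (true_positions w) = count id w.
Proof.
rewrite -{2}[w]take_size count_take_true_positions; apply/esym/eqP.
rewrite -all_count; apply/allP => p.
by rewrite mem_filter mem_iota add0n => /andP[_ /andP[]].
Qed.

(** * Ballot condition and threshold inequalities *)

Lemma ballot_of_threshold w :
    (forall i, i < size (true_positions w) -> 3 * i.+1 <= nth 0 (true_positions w) i) ->
  ballot w.
Proof.
move=> thr k k_gt0; rewrite count_take_true_positions.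
elim/last_ind: (true_positions w) thr => [|s x IHs] // thr.
rewrite -cats1 count_cat /= addn0.
case: (ltnP x k) => [lt_xk|_].
  have := thr (size s); rewrite size_rcons nth_rcons ltnn eqxx ltnSn.
  by move=> /(_ isT); have := count_size (fun p => p < k) s; lia.
rewrite addn0; apply: IHs => i lt_is.
by have := thr i; rewrite size_rcons nth_rcons lt_is; apply; apply: ltnW.
Qed.

Lemma threshold_of_ballot w i : ballot w -> i < size (true_positions w) ->
  3 * i.+1 <= nth 0 (true_positions w) i.
Proof.
move=> bw; set s := true_positions w => lt_is; set x := nth 0 s i.
(* The prefix ending just after position [x] contains at least [i.+1] letters [true], so 3(i+1) <
   x+1. *)
have := bw x.+1 isT; rewrite count_take_true_positions -/s.
suff: i.+1 <= count (fun p => p < x.+1) s by lia.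
rewrite -(cat_take_drop i.+1 s) count_cat.
apply: leq_trans (leq_addr _ _).
suff /eqP-> : count (fun p => p < x.+1) (take i.+1 s) == size (take i.+1 s).
  by rewrite size_takel.
rewrite -all_count; apply/(all_nthP 0) => j; rewrite size_takel // => lt_ji.
rewrite nth_take //.
have s_sorted := sorted_true_positions w.
rewrite ltnS leq_eqVlt; move: lt_ji; rewrite ltnS leq_eqVlt => /orP[/eqP->|lt_ji].
  by rewrite eqxx.
by rewrite (sorted_ltn_nth ltn_trans) ?orbT // inE; lia.
Qed.

(** Leaving [r] free serves both directions: it is [map absz s] for a given sequence and
    [true_positions] for a given tree. *)
Lemma is_simple_3thresholdP n (s : n.-tuple int) (r : seq nat) :
    map Posz r = s ->
  reflect (sorted ltn r /\ forall i, i < n -> 3 * i.+1 <= nth 0 r i <= 3 * n)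
          (is_simple_3threshold s).
Proof.
move=> rs; have szr : size r = n by rewrite -(size_tuple s) -rs size_map.
have sE (i : 'I_n) : tnth s i = Posz (nth 0 r i).
  by rewrite (tnth_nth (Posz 0)) -rs (nth_map 0) ?szr.
rewrite /is_simple_3threshold -rs sorted_map.
apply: (iffP andP) => -[r_sorted r_bnd]; split=> //.
  by move=> i lt_in; have /forallP/(_ (Ordinal lt_in)) := r_bnd; rewrite sE.
by apply/forallP => i; rewrite sE; exact: r_bnd.
Qed.

(** * Passage between integer sequences and trees *)

Lemma is_simple_3threshold_abszK n (s : n.-tuple int) :
  is_simple_3threshold s -> map Posz (map absz s) = s.
Proof.
case/andP=> _ /forallP s_bnd; rewrite -map_comp map_id_in // => x /tnthP[i ->] /=.
by have := s_bnd i; lia.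
Qed.

(** With length 3n+1 the last position is 3n, exactly the upper bound on the entries. *)
Definition threshold_word (n : nat) (s : seq int) : bitseq :=
  word_of_positions (3 * n).+1 (map absz s).

Lemma threshold_wordP n (s : n.-tuple int) : is_simple_3threshold s ->
  map Posz (true_positions (threshold_word n s)) = s
  /\ postorder (head TTrivial (parse (threshold_word n s))) = threshold_word n s.
Proof.
move=> s_thr; have sK := is_simple_3threshold_abszK s_thr.
have [r_sorted r_bnd] := is_simple_3thresholdP sK s_thr.
have szr : size (map absz s) = n by rewrite size_map size_tuple.
have posK : true_positions (threshold_word n s) = map absz s.
  apply: word_of_positionsK => //; apply/(all_nthP 0) => i.
  by rewrite szr => /r_bnd /andP[].
split; first by rewrite posK.
apply: (@postorder_parse _ n).
- by apply: ballot_of_threshold => i; rewrite posK szr => /r_bnd /andP[].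
- by rewrite size_map size_iota.
- by rewrite -size_true_positions posK.
Qed.

Lemma internal_nodes_parse n (s : n.-tuple int) : is_simple_3threshold s ->
  internal_nodes (head TTrivial (parse (threshold_word n s))) == n.
Proof.
case/threshold_wordP=> sK tK; rewrite -count_postorder tK -size_true_positions.
by rewrite -(size_map Posz) sK size_tuple.
Qed.

Definition tree_positions (t : ternary_tree) : seq int :=
  map Posz (true_positions (postorder t)).

Lemma size_tree_positions n t : internal_nodes t == n -> size (tree_positions t) == n.
Proof. by rewrite size_map size_true_positions count_postorder. Qed.

Lemma tree_positions_threshold n t (tn : internal_nodes t == n) :
  is_simple_3threshold (Tuple (size_tree_positions tn)).
Proof.
apply/(@is_simple_3thresholdP _ _ (true_positions (postorder t))) => //.
split=> [|i lt_in]; first exact: sorted_true_positions.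
have lt_i : i < size (true_positions (postorder t)).
  by rewrite size_true_positions count_postorder (eqP tn).
rewrite (threshold_of_ballot (ballot_postorder t) lt_i) /=.
(* The upper bound 3n holds because the entry is a position in a word of length 3n+1. *)
have := mem_nth 0 lt_i; rewrite mem_filter mem_iota size_postorder (eqP tn) add0n.
by case/and3P.
Qed.

Lemma threshold_word_tree_positions n t : internal_nodes t == n ->
  threshold_word n (tree_positions t) = postorder t.
Proof.
move=> /eqP <-; rewrite /threshold_word /tree_positions -map_comp map_id.
by rewrite -size_postorder true_positionsK.
Qed.

Theorem proposition2p2 (n : nat) (hn : 1 <= n) :
  exists f : simple_3threshold_seq n -> ternary_tree_with n, bijective f.
Proof.
pose f (s : simple_3threshold_seq n) : ternary_tree_with n :=
  exist (fun t => internal_nodes t == n) _ (internal_nodes_parse (valP s)).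
pose g (t : ternary_tree_with n) : simple_3threshold_seq n :=
  exist (fun s => is_simple_3threshold s) _ (tree_positions_threshold (valP t)).
exists f; exists g => [s|t]; apply: val_inj => /=.
  apply: val_inj => /=; have [sK tK] := threshold_wordP (valP s).
  by rewrite /tree_positions tK.
by rewrite (threshold_word_tree_positions (valP t)) /parse foldl_postorder.
Qed.
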